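(* The double well potential function $g$ on $\mathbb{R}^n$ has a local maximizer if and only if $\nu-\alpha_n>0$ and there is a $\overline{t}^*\in[0,2\nu-2\alpha_n)$ such that the secular function $h$ satisfies $h(\overline{t}^* )=0$ and $h'(\overline{t}^* )<0$. Moreover, if it exists, the local maximizer $\overline{w}$ is given by $$\overline{w}=\left(\frac{2\psi_1}{\overline{t}^*-2\nu+2\alpha_1},\ldots,\frac{2\psi_n}{\overline{t}^*-2\nu+2\alpha_n}\right).$$
   Context: Let $n\ge 1$ be an integer, $\nu\in\mathbb{R}$, $\psi=(\psi_1,\dots,\psi_n)^T\in\mathbb{R}^n$, and $D=\mathrm{Diag}(\alpha_1,\dots,\alpha_n)$ a real diagonal matrix with $\alpha_1\le\alpha_2\le\dots\le\alpha_n$. The double well potential function is $g:\mathbb{R}^n\to\mathbb{R}$, $$g(w)=\frac12\left(\frac12\|w\|^2-\nu\right)^2+\frac12 w^TDw-\psi^Tw,$$ where $\|\cdot\|$ is the Euclidean norm. If $\psi\ne 0$, let $k\in\{1,\dots,n\}$ be the largest index with $\psi_k\neq 0$ (so $\psi_{k+1}=\dots=\psi_n=0$); the secular function is $$h(t)=\sum_{i=1}^k\frac{4\psi_i^2}{(t-2\nu+2\alpha_i)^2}-t,\qquad t\in[0,2\nu-2\alpha_k).$$ If $\psi=0$, the secular function is $h(t)=-t$. The derivative $h'$ is that of the displayed formula (one-sided at $t=0$, equivalently the value of the derivative of the formula there). *)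

(* Defs.v *)
From HB Require Import structures.
From mathcomp Require Import all_boot all_order all_algebra.
From mathcomp Require Import all_classical all_reals all_analysis.
Set Implicit Arguments.
Unset Strict Implicit.
Unset Printing Implicit Defensive.
Import Order.TTheory GRing.Theory Num.Theory.
Import numFieldNormedType.Exports.
Local Open Scope classical_set_scope.
Local Open Scope ring_scope.

(* The library norm on matrices is the sup norm, hence this definition. *)
Definition enorm (R : realType) (n : nat) (w : 'cV[R]_n) : R :=
  Num.sqrt (\sum_(i < n) w i 0 ^+ 2).

Definition double_well (R : realType) (n : nat) (nu : R) (psi : 'cV[R]_n)
    (alpha : 'rV[R]_n) (w : 'cV[R]_n) : R :=
  2^-1 * (2^-1 * enorm w ^+ 2 - nu) ^+ 2
  + 2^-1 * (w^T *m diag_mx alpha *m w) 0 0 - (psi^T *m w) 0 0.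

(* The (product) topology of 'cV[R]_n is the Euclidean one. *)
Definition local_maximizer (R : realType) (n : nat) (f : 'cV[R]_n -> R)
    (w : 'cV[R]_n) : Prop :=
  \forall u \near w, f u <= f w.

(* One-based: the largest k in {1, ..., n} such that the k-th coordinate of psi
   is nonzero, and 0 if psi = 0. *)
Definition last_nonzero (R : realType) (n : nat) (psi : 'cV[R]_n) : nat :=
  (\max_(i < n | psi i ord0 != 0%R) i.+1)%N.

(* The sum ranges over the one-based indices 1, ..., last_nonzero psi; it is
   empty if psi = 0. With k := last_nonzero psi > 0, the function is only
   meaningful on [0, 2 nu - 2 alpha_k[, where no denominator vanishes; as the
   formula is smooth around each point of this interval, including 0, its
   two-sided derivative at 0 is also the one-sided one. *)
Definition secular (R : realType) (n : nat) (nu : R) (psi : 'cV[R]_n)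
    (alpha : 'rV[R]_n) (t : R) : R :=
  \sum_(i < n | (i < last_nonzero psi)%N)
    4 * psi i 0 ^+ 2 / (t - 2 * nu + 2 * alpha 0 i) ^+ 2 - t.

(* Main.v *)
(* Write d_i(t) = t - 2 nu + 2 alpha_i, and d_i = d_i(|w|^2).  With a = <w, v>
   and b = |v|^2, the potential has the exact expansion
     g(w + v) - g(w) = (a + b/2)^2 / 2 + (sum_i v_i (d_i w_i - 2 psi_i)) / 2
                       + (sum_i d_i v_i^2) / 4.
   Along a line it is a quartic polynomial whose lowest nonzero term must be
   even and negative at a maximizer.  Testing suitable directions gives
   d_i w_i = 2 psi_i, then d_i < 0, then sum_i w_i^2 / (- d_i) < 1/2 (direction
   v_i = w_i / (- d_i)).  With t = |w|^2 these say exactly that h(t) = 0 and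
   h'(t) < 0.  Conversely the weighted Cauchy-Schwarz inequality bounds
   (a + b/2)^2 by (sum_i - d_i v_i^2) (sum_i (w_i + v_i / 2)^2 / (- d_i)), whose
   last factor stays below 1/2 near v = 0.  Finally h is convex where all
   d_i(t) < 0, so it has at most one zero with negative slope there. *)
Require Import Defs.
From HB Require Import structures.
From mathcomp Require Import all_boot all_order all_algebra.
From mathcomp Require Import all_classical all_reals all_analysis.
From mathcomp Require Import ring lra.
Import Order.TTheory GRing.Theory Num.Theory.
Import numFieldNormedType.Exports.
Local Open Scope classical_set_scope.
Local Open Scope ring_scope.

(** The quadratic [P - 2 * z * S + z ^+ 2 * Q] is a sum of squares over positive weights, so it is
    never negative; [z = S / Q] gives the bound. *)
Lemma cauchy_schwarz_weighted (R : realType) (n : nat) (c x y : 'I_n -> R) :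
  (forall i, 0 < c i) ->
  (\sum_i x i * y i) ^+ 2 <=
    (\sum_i c i * x i ^+ 2) * (\sum_i y i ^+ 2 / c i).
Proof.
move=> c_gt0.
set P := \sum_i c i * _; set Q := \sum_i _ / _; set S := \sum_i _.
have Q_ge0 : 0 <= Q.
  by apply: sumr_ge0 => i _; rewrite divr_ge0 ?sqr_ge0 ?ltW.
have quad z : 0 <= P - 2 * z * S + z ^+ 2 * Q.
  rewrite [X in 0 <= X](_ : _ = \sum_i (c i * x i - z * y i) ^+ 2 / c i).
    by apply: sumr_ge0 => i _; rewrite divr_ge0 ?sqr_ge0 ?ltW.
  rewrite /P /Q /S !mulr_sumr -sumrB -big_split; apply: eq_bigr => i _ /=.
  by field; rewrite gt_eqF.
have [Q0|Q_neq0] := eqVneq Q 0.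
  have [S0|S_neq0] := eqVneq S 0; first by rewrite S0 Q0 mulr0 expr0n.
  (* With [Q = 0] the quadratic is affine in [z], and this [z] gives it the value -1. *)
  have := quad ((P + 1) / (2 * S)); rewrite Q0.
  have -> : 2 * ((P + 1) / (2 * S)) * S = P + 1 by field.
  by rewrite mulr0; lra.
have Q_gt0 : 0 < Q by rewrite lt_def Q_neq0.
have := quad (S / Q).
have -> : P - 2 * (S / Q) * S + (S / Q) ^+ 2 * Q = (P * Q - S ^+ 2) / Q by field.
by rewrite pmulr_lge0 ?invr_gt0// subr_ge0.
Qed.

(** Convexity of the inverse square, as a tangent inequality at [d]: the gap has the factor
    [(d - c) ^+ 2]. *)
Lemma inv_sqr_tangent (R : realFieldType) (c d : R) : 0 < c -> 0 < d ->
  d^-1 ^+ 2 - 2 * d^-1 ^+ 3 * (c - d) <= c^-1 ^+ 2.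
Proof.
move=> c_gt0 d_gt0; rewrite -subr_ge0.
have -> : c^-1 ^+ 2 - (d^-1 ^+ 2 - 2 * d^-1 ^+ 3 * (c - d))
   = (d - c) ^+ 2 * (d + 2 * c) / (c ^+ 2 * d ^+ 3).
  by field; rewrite !gt_eqF.
apply: divr_ge0; apply: mulr_ge0; rewrite ?sqr_ge0 ?exprn_ge0 ?addr_ge0 ?mulr_ge0 ?ltW//.
Qed.


(** * Sign of the lowest-order term along a line *)

Section LineTests.
Context {R : realType}.
Implicit Types f : R -> R.

Lemma near0_expr_mul_le0 f k : {for 0, continuous f} ->
  (\forall s \near (0 : R), s ^+ k * f s <= 0) -> f 0 <= 0.
Proof.
move=> cf le0; rewrite leNgt; apply/negP => f0_gt0.
have f_gt0 : \forall s \near (0 : R), 0 < f s by exact: (cvgr_gt _ cf).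
near (0 : R)^'+ => s.
have s_gt0 : 0 < s by near: s; exact: nbhs_right_gt.
have : s ^+ k * f s <= 0 by near: s; apply: cvg_within.
rewrite leNgt mulr_gt0 ?exprn_gt0//.
by near: s; exact: cvg_within.
Unshelve. all: end_near. Qed.

(** An odd power changes sign with [s], so [fun s => - f (- s)] passes the same test, which gives
    the opposite bound. *)
Lemma near0_expr_odd_mul_le0 f k : odd k -> {for 0, continuous f} ->
  (\forall s \near (0 : R), s ^+ k * f s <= 0) -> f 0 = 0.
Proof.
move=> odd_k cf le0; apply/eqP; rewrite eq_le (near0_expr_mul_le0 _ k)//=.
rewrite -oppr_le0 -[X in f X]oppr0; apply: (near0_expr_mul_le0 (fun s => - f (- s)) k).
  apply: continuousN; apply: continuous_comp; first exact: opp_continuous.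
  by rewrite oppr0.
have opp0 : (-%R : R -> R) s @[s --> (0 : R)] --> (0 : R).
  by rewrite -[X in _ --> X]oppr0; exact: opp_continuous.
have := opp0 _ le0; rewrite /= !nbhs_simpl /=; apply: filterS => s /=.
by rewrite exprNn -signr_odd odd_k expr1 mulN1r mulNr mulrN.
Qed.

(** Shape of the cofactor once the leading power of [s] is taken out of the quartic increment;
    shorter cofactors are padded with zeros. *)
Lemma continuous_cubic (a b c d : R) :
  continuous (fun s : R => a + s * b + s ^+ 2 * c + s ^+ 3 * d).
Proof.
have cX k x : continuous (fun s : R => s ^+ k * x).
  by move=> s; apply: cvgM; [exact: exprn_continuous|exact: cvg_cst].
by move=> s; do !apply: cvgD; [exact: cvg_cst|exact: (cX 1)|exact: cX|exact: cX].
Qed.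
End LineTests.

(** * Local maximizers of the potential and zeros of the secular function *)

Section DoubleWell.
Context {R : realType} {n : nat} {nu : R} {psi : 'cV[R]_n} {alpha : 'rV[R]_n}.
Implicit Types (v w : 'cV[R]_n) (t : R) (i : 'I_n).

(** At [t] equal to the squared norm of [w], half of [den t i * w i 0 - 2 * psi i 0] is the [i]-th
    partial derivative of the potential. *)
Let den t i : R := t - 2 * nu + 2 * alpha 0 i.

Lemma double_wellE w : double_well nu psi alpha w =
  2^-1 * (2^-1 * \sum_i w i 0 ^+ 2 - nu) ^+ 2
  + 2^-1 * \sum_i alpha 0 i * w i 0 ^+ 2 - \sum_i psi i 0 * w i 0.
Proof.
rewrite /double_well /enorm sqr_sqrtr; last by apply: sumr_ge0 => i _; exact: sqr_ge0.
rewrite [in _ *m w]mul_mx_diag !mxE.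
congr (_ + 2^-1 * _ - _); apply: eq_bigr => i _; rewrite !mxE//.
by ring.
Qed.

Lemma double_well_increment w v :
  double_well nu psi alpha (w + v) - double_well nu psi alpha w =
  2^-1 * (\sum_i w i 0 * v i 0 + 2^-1 * \sum_i v i 0 ^+ 2) ^+ 2
  + 2^-1 * \sum_i v i 0 * (den (\sum_j w j 0 ^+ 2) i * w i 0 - 2 * psi i 0)
  + 4^-1 * \sum_i den (\sum_j w j 0 ^+ 2) i * v i 0 ^+ 2.
Proof.
rewrite !double_wellE.
set S := \sum_i w i 0 ^+ 2; set a := \sum_i w i 0 * v i 0.
set b := \sum_i v i 0 ^+ 2.
have -> : \sum_i (w + v) i 0 ^+ 2 = S + 2 * a + b.
  rewrite /S /a /b mulr_sumr -!big_split; apply: eq_bigr => i _ /=.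
  by rewrite mxE; ring.
have -> : \sum_i alpha 0 i * (w + v) i 0 ^+ 2 = \sum_i alpha 0 i * w i 0 ^+ 2
   + 2 * (\sum_i alpha 0 i * w i 0 * v i 0) + \sum_i alpha 0 i * v i 0 ^+ 2.
  rewrite mulr_sumr -!big_split; apply: eq_bigr => i _ /=.
  by rewrite mxE; ring.
have -> : \sum_i psi i 0 * (w + v) i 0
    = \sum_i psi i 0 * w i 0 + \sum_i psi i 0 * v i 0.
  by rewrite -big_split; apply: eq_bigr => i _ /=; rewrite mxE mulrDr.
have -> : \sum_i v i 0 * (den S i * w i 0 - 2 * psi i 0) = (S - 2 * nu) * a
    + 2 * (\sum_i alpha 0 i * w i 0 * v i 0) - 2 * (\sum_i psi i 0 * v i 0).
  rewrite /a !mulr_sumr -big_split -sumrB; apply: eq_bigr => i _ /=.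
  by rewrite /den; ring.
have -> : \sum_i den S i * v i 0 ^+ 2
    = (S - 2 * nu) * b + 2 * (\sum_i alpha 0 i * v i 0 ^+ 2).
  rewrite /b !mulr_sumr -big_split; apply: eq_bigr => i _ /=.
  by rewrite /den; ring.
by field.
Qed.

(** The added terms have numerator 0, so they vanish whatever their denominator. *)
Lemma secularE t :
  secular nu psi alpha t = \sum_i 4 * psi i 0 ^+ 2 / den t i ^+ 2 - t.
Proof.
rewrite /secular big_mkcond; congr (_ - _); apply: eq_bigr => i _ /=.
case: ltnP => // le_i; have [->|psi_i] := eqVneq (psi i 0) 0.
  by rewrite expr0n mulr0 mul0r.
have := @leq_bigmax_cond _ (fun j => psi j 0 != 0) (fun j => j.+1) i psi_i.
by rewrite ltnNge le_i.
Qed.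

Lemma derive1_secular t : (forall i, den t i != 0) ->
  derive1 (secular nu psi alpha) t
  = - \sum_i 8 * psi i 0 ^+ 2 / den t i ^+ 3 - 1.
Proof.
move=> den_neq0; rewrite derive1E; apply: derive_val.
have -> : secular nu psi alpha = (\sum_i (fun s => 4 * psi i 0 ^+ 2 / den s i ^+ 2)) - id.
  by apply/funext => s; rewrite secularE !fctE fct_sumE.
apply: is_deriveB; rewrite -sumrN; apply: is_derive_sum => i.
pose k := 2 * alpha 0 i - 2 * nu.
have denE : den^~ i = shift k by apply/funext => s; rewrite /den /k /=; ring.
have -> : (fun s => 4 * psi i 0 ^+ 2 / den s i ^+ 2)
    = (4 * psi i 0 ^+ 2) \*: (fun s => (den s i)^-1) ^+ 2.
  by apply/funext => s; rewrite !fctE -exprVn.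
have dden : is_derive t 1 (den^~ i) 1 by rewrite denE; exact: is_derive_shift.
have dinv := @is_deriveV _ (den^~ i) t 1 1 (den_neq0 i) dden.
apply: is_derive_eq; rewrite /= /GRing.scale /=.
by field.
Qed.

Lemma local_maximizerP w : local_maximizer (double_well nu psi alpha) w <->
  [/\ forall i, den (\sum_j w j 0 ^+ 2) i < 0,
      forall i, den (\sum_j w j 0 ^+ 2) i * w i 0 = 2 * psi i 0
    & \sum_i w i 0 ^+ 2 / - den (\sum_j w j 0 ^+ 2) i < 2^-1].
Proof.
pose d := den (\sum_j w j 0 ^+ 2); rewrite -/d; split=> [wmax|[d_lt0 crit slope]].
  pose a v := \sum_i w i 0 * v i 0; pose b v := \sum_i v i 0 ^+ 2.
  (* [A v] and [B v] are the coefficients of [s] and [s ^+ 2] in the increment from [w] to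
     [w + s *: v]. *)
  pose A v := 2^-1 * \sum_i v i 0 * (d i * w i 0 - 2 * psi i 0).
  pose B v := 2^-1 * a v ^+ 2 + 4^-1 * \sum_i d i * v i 0 ^+ 2.
  have line v : \forall s \near (0 : R),
      s * A v + s ^+ 2 * B v + s ^+ 3 * (2^-1 * a v * b v) + s ^+ 4 * (8^-1 * b v ^+ 2) <= 0.
    have cvg_w : w + s *: v @[s --> (0 : R)] --> w.
      rewrite -[X in _ --> X]addr0 -(scale0r v).
      by apply: cvgD; [exact: cvg_cst|apply: cvgZr_tmp; exact: cvg_id].
    have := cvg_w _ wmax; rewrite /= !nbhs_simpl /=; apply: filterS => s /=.
    rewrite -subr_le0 double_well_increment -/d; apply: le_trans.
    rewrite le_eqVlt; apply/orP; left; apply/eqP.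
    have -> : \sum_i w i 0 * (s *: v) i 0 = s * a v.
      by rewrite mulr_sumr; apply: eq_bigr => i _; rewrite mxE; ring.
    have -> : \sum_i (s *: v) i 0 ^+ 2 = s ^+ 2 * b v.
      by rewrite mulr_sumr; apply: eq_bigr => i _; rewrite mxE; ring.
    have -> : \sum_i (s *: v) i 0 * (d i * w i 0 - 2 * psi i 0) = s * (2 * A v).
      by rewrite /A [2 * (_ * _)]mulrA mulfV// mul1r mulr_sumr; apply: eq_bigr => i _; rewrite mxE; ring.
    have -> : \sum_i d i * (s *: v) i 0 ^+ 2 = s ^+ 2 * \sum_i d i * v i 0 ^+ 2.
      by rewrite mulr_sumr; apply: eq_bigr => i _; rewrite mxE; ring.
    by rewrite /B; field.
  have A_eq0 v : A v = 0.
    have := near0_expr_odd_mul_le0 (fun s => A v + s * B v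
      + s ^+ 2 * (2^-1 * a v * b v) + s ^+ 3 * (8^-1 * b v ^+ 2)) 1 isT.
    rewrite !expr0n !mul0r !addr0; apply; first exact: continuous_cubic.
    apply: filterS (line v) => s; apply: le_trans.
    by rewrite le_eqVlt; apply/orP; left; apply/eqP; ring.
  have B_le0 v : B v <= 0.
    have := near0_expr_mul_le0 (fun s => B v
      + s * (2^-1 * a v * b v) + s ^+ 2 * (8^-1 * b v ^+ 2) + s ^+ 3 * 0) 2.
    rewrite !expr0n !mul0r !addr0; apply; first exact: continuous_cubic.
    apply: filterS (line v) => s; rewrite A_eq0; apply: le_trans.
    by rewrite le_eqVlt; apply/orP; left; apply/eqP; ring.
  (* If [B v] were 0, the cubic coefficient would vanish too, and the quartic one, a positive
     multiple of [b v ^+ 2], would force [v = 0]. *)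
  have B_neq0 v : v != 0 -> B v < 0.
    move=> v_neq0; rewrite lt_neqAle B_le0 andbT; apply/eqP => B0.
    have C0 : 2^-1 * a v * b v = 0.
      have := near0_expr_odd_mul_le0 (fun s => 2^-1 * a v * b v
        + s * (8^-1 * b v ^+ 2) + s ^+ 2 * 0 + s ^+ 3 * 0) 3 isT.
      rewrite !expr0n !mul0r !addr0; apply; first exact: continuous_cubic.
      apply: filterS (line v) => s; rewrite A_eq0 B0; apply: le_trans.
      by rewrite le_eqVlt; apply/orP; left; apply/eqP; ring.
    have D0 : 8^-1 * b v ^+ 2 <= 0.
      have := near0_expr_mul_le0 (fun s => 8^-1 * b v ^+ 2 + s * 0 + s ^+ 2 * 0 + s ^+ 3 * 0) 4.
      rewrite !expr0n !mul0r !addr0; apply; first exact: continuous_cubic.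
      apply: filterS (line v) => s; rewrite A_eq0 B0 C0; apply: le_trans.
      by rewrite le_eqVlt; apply/orP; left; apply/eqP; ring.
    have b0 : b v = 0.
      apply/eqP; rewrite -sqrf_eq0 eq_le sqr_ge0 andbT.
      by move: D0; rewrite pmulr_rle0.
    case/eqP: v_neq0; apply/colP => i; rewrite mxE; apply/eqP.
    rewrite -sqrf_eq0; apply/eqP.
    by apply: (psumr_eq0P _ b0) => // j _; exact: sqr_ge0.
  have crit i : d i * w i 0 = 2 * psi i 0.
    apply/eqP; rewrite -subr_eq0 -sqrf_eq0; apply/eqP.
    (* Along the gradient direction, [A] is half a sum of squares. *)
    have := A_eq0 (\col_j (d j * w j 0 - 2 * psi j 0)).
    rewrite /A => /eqP; rewrite mulf_eq0 invr_eq0 pnatr_eq0/= => /eqP sum0.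
    apply: (psumr_eq0P (P := predT) (F := fun j => (d j * w j 0 - 2 * psi j 0) ^+ 2)) => //.
      by move=> j _; exact: sqr_ge0.
    by rewrite -[RHS]sum0; apply: eq_bigr => j _; rewrite mxE expr2.
  have d_lt0 i : d i < 0.
    have /B_neq0 : delta_mx i 0 != 0 :> 'cV[R]_n.
      by apply/eqP => /colP/(_ i); rewrite !mxE !eqxx/=; apply/eqP; exact: oner_neq0.
    have sum_delta (f : 'I_n -> R) : \sum_j f j * (delta_mx i 0 : 'cV[R]_n) j 0 = f i.
      rewrite (bigD1 i)//= mxE !eqxx mulr1 big1 ?addr0// => j /negPf ji.
      by rewrite mxE ji mulr0.
    (* Basis vectors have entries equal to their squares, so [B] becomes
       [w i 0 ^+ 2 / 2 + d i / 4]. *)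
    rewrite /B /a sum_delta (eq_bigr (fun j => d j * (delta_mx i 0 : 'cV[R]_n) j 0)) => [|j _].
      by rewrite sum_delta; have := sqr_ge0 (w i 0); lra.
    by rewrite !mxE eqxx andbT; case: (j == i); rewrite /= ?expr0n ?expr1n.
  split=> //.
  set q := \sum_i _.
  pose v : 'cV[R]_n := \col_i (w i 0 / - d i).
  have av : a v = q by apply: eq_bigr => i _; rewrite mxE; ring.
  have dv : \sum_i d i * v i 0 ^+ 2 = - q.
    by rewrite -sumrN; apply: eq_bigr => i _; rewrite mxE; field; rewrite lt_eqF.
  have [v0|v_neq0] := eqVneq v 0.
    by rewrite -av v0 /a big1 ?invr_gt0// => i _; rewrite mxE mulr0.
  (* Here [B v = q * (q - 2^-1) / 2], which is negative only if [q < 2^-1]. *)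
  have := B_neq0 _ v_neq0; rewrite /B av dv => Bq; rewrite ltNge; apply/negP => q_ge.
  have : 0 <= q * (q - 2^-1) by rewrite mulr_ge0 ?subr_ge0//; lra.
  by nra.
have c_gt0 i : 0 < - d i by rewrite oppr_gt0.
(* The second Cauchy-Schwarz factor as a function of [u = w + v]; at [u = w] it is the sum bounded
   by [slope]. *)
pose Q (u : 'cV[R]_n) := \sum_i (w i 0 + 2^-1 * (u i 0 - w i 0)) ^+ 2 / - d i.
have cQ : continuous Q.
  apply: continuous_big => [|i _ u]; first exact: add_continuous.
  apply: (@continuous_comp _ _ _ (fun u : 'cV[R]_n => u i 0)
    (fun x => (w i 0 + 2^-1 * (x - w i 0)) ^+ 2 / - d i)).
    exact: coord_continuous.
  apply: cvgM; last exact: cvg_cst.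
  apply: (@cvg_comp _ _ _ _ (fun x : R => x ^+ 2)); last exact: exprn_continuous.
  apply: cvgD; first exact: cvg_cst.
  by apply: cvgM; [exact: cvg_cst|apply: cvgB; [exact: cvg_id|exact: cvg_cst]].
have Qw : Q w < 2^-1.
  by rewrite /Q; under eq_bigr => i _ do rewrite subrr mulr0 addr0.
have : \forall u \near w, Q u < 2^-1 by exact: (cvgr_lt _ (cQ w)).
apply: filterS => u Qu; rewrite -subr_le0.
have -> : u = w + (u - w) by rewrite addrC subrK.
rewrite double_well_increment -/d.
set v := u - w.
have -> : \sum_i v i 0 * (d i * w i 0 - 2 * psi i 0) = 0.
  by rewrite big1// => i _; rewrite crit subrr mulr0.
have cs := cauchy_schwarz_weighted _ _ (fun i => - d i) (v^~ 0) (fun i => w i 0 + 2^-1 * v i 0) c_gt0.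
have dvE : \sum_i d i * v i 0 ^+ 2 = - \sum_i - d i * v i 0 ^+ 2.
  by rewrite -sumrN; apply: eq_bigr => i _; rewrite mulNr opprK.
have wvE : \sum_i w i 0 * v i 0 + 2^-1 * \sum_i v i 0 ^+ 2
    = \sum_i v i 0 * (w i 0 + 2^-1 * v i 0).
  by rewrite mulr_sumr -big_split; apply: eq_bigr => i _ /=; ring.
rewrite wvE dvE; move: cs.
have -> : \sum_i (w i 0 + 2^-1 * v i 0) ^+ 2 / - d i = Q u.
  by apply: eq_bigr => i _; rewrite !mxE.
have : 0 <= \sum_i - d i * v i 0 ^+ 2.
  by apply: sumr_ge0 => i _; rewrite mulr_ge0 ?sqr_ge0 ?ltW.
move: (\sum_i _) (_ ^+ 2) => V X V_ge0 cs.
(* Since [X <= V * Q u], the increment [X / 2 - V / 4] is at most [- V * (2^-1 - Q u) / 2]. *)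
have : 0 <= V * (2^-1 - Q u) by rewrite mulr_ge0// subr_ge0 ltW.
by lra.
Qed.

(** Translates the conditions on [w] into conditions on the secular function: substituting
    [psi i 0 = den t i * w i 0 / 2] cancels the squared denominators. *)
Lemma secular_critical w t : (forall i, den t i < 0) ->
  (forall i, den t i * w i 0 = 2 * psi i 0) ->
  secular nu psi alpha t = \sum_i w i 0 ^+ 2 - t /\
  derive1 (secular nu psi alpha) t = 2 * (\sum_i w i 0 ^+ 2 / - den t i) - 1.
Proof.
move=> den_lt0 crit; have psiE i : psi i 0 = 2^-1 * (den t i * w i 0).
  by rewrite crit mulKf.
rewrite secularE derive1_secular => [|i]; last by rewrite lt_eqF.
split; congr (_ - _); last rewrite mulr_sumr -sumrN; apply: eq_bigr => i _.
  by rewrite psiE; field; rewrite lt_eqF.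
by rewrite psiE; field; rewrite lt_eqF.
Qed.

(** The tangent at the larger zero slopes down, so it is positive at the smaller one, where
    convexity keeps the function above it. *)
Lemma secular_root_unique s t :
  (forall i, den s i < 0) -> (forall i, den t i < 0) ->
  secular nu psi alpha s = 0 -> secular nu psi alpha t = 0 ->
  derive1 (secular nu psi alpha) s < 0 -> derive1 (secular nu psi alpha) t < 0 ->
  s = t.
Proof.
suff lt_absurd s' t' : (forall i, den s' i < 0) -> (forall i, den t' i < 0) ->
    s' < t' -> secular nu psi alpha s' = 0 -> secular nu psi alpha t' = 0 ->
    derive1 (secular nu psi alpha) t' < 0 -> False.
  move=> ds dt hs ht ds' dt'.
  by case: (ltgtP s t) => // [/(lt_absurd s t)|/(lt_absurd t s)]; case.
move=> ds dt lt_st hs ht; rewrite derive1_secular => [dh|i]; last by rewrite lt_eqF.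
have : secular nu psi alpha t'
    + (- (\sum_i 8 * psi i 0 ^+ 2 / den t' i ^+ 3) - 1) * (s' - t')
    <= secular nu psi alpha s'.
  rewrite !secularE mulrDl mulN1r mulNr mulr_suml.
  rewrite [X in X <= _](_ : _ = \sum_i (4 * psi i 0 ^+ 2 / den t' i ^+ 2
      - 8 * psi i 0 ^+ 2 / den t' i ^+ 3 * (s' - t')) - s'); last first.
    by rewrite sumrB; ring.
  rewrite lerD2r; apply: ler_sum => i _.
  (* The denominators are negative, hence the sign changes. *)
  have := @inv_sqr_tangent _ (- den s' i) (- den t' i).
  rewrite !oppr_gt0 => /(_ (ds i) (dt i)) /(ler_wpM2l (mulr_ge0 (ler0n R 4) (sqr_ge0 (psi i 0)))).
  congr (_ <= _); last by rewrite invrN sqrrN exprVn.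
  by rewrite /den; field; rewrite -/(den t' i) lt_eqF.
rewrite hs ht add0r leNgt => /negP; apply.
by rewrite nmulr_rgt0// subr_lt0.
Qed.
End DoubleWell.

(* MathComp-Analysis; the dimension is n.+1 and alpha 0 ord_max is the largest
   diagonal entry. *)
Theorem theorem5 (R : realType) (n : nat) (nu : R) (psi : 'cV[R]_n.+1)
    (alpha : 'rV[R]_n.+1)
    (alpha_le : forall i j : 'I_n.+1, (i <= j)%N -> alpha 0 i <= alpha 0 j) :
  ((exists w : 'cV[R]_n.+1, local_maximizer (double_well nu psi alpha) w) <->
   (0 < nu - alpha 0 ord_max /\
    exists t : R,
      [/\ 0 <= t < 2 * nu - 2 * alpha 0 ord_max,
          secular nu psi alpha t = 0 &
          derive1 (secular nu psi alpha) t < 0])) /\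
  (forall (w : 'cV[R]_n.+1) (t : R),
     local_maximizer (double_well nu psi alpha) w ->
     0 <= t < 2 * nu - 2 * alpha 0 ord_max ->
     secular nu psi alpha t = 0 ->
     derive1 (secular nu psi alpha) t < 0 ->
     w = \col_i (2 * psi i 0 / (t - 2 * nu + 2 * alpha 0 i))).
Proof.
have den_lt0 t : t < 2 * nu - 2 * alpha 0 ord_max ->
    forall i, t - 2 * nu + 2 * alpha 0 i < 0.
  by move=> t_lt i; have := alpha_le i ord_max (leq_ord i); lra.
have critical w : local_maximizer (double_well nu psi alpha) w ->
    let t := \sum_i w i 0 ^+ 2 in
    [/\ 0 <= t < 2 * nu - 2 * alpha 0 ord_max, secular nu psi alpha t = 0
      & derive1 (secular nu psi alpha) t < 0].
  case/local_maximizerP => d_lt0 crit slope /=.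
  have [-> ->] := secular_critical _ _ d_lt0 crit.
  split; [|by rewrite subrr|by lra].
  rewrite sumr_ge0/= => [|i _]; last exact: sqr_ge0.
  by have := d_lt0 ord_max; lra.
split; first split.
- case=> w /critical [t_range ht dht]; split; last by exists (\sum_i w i 0 ^+ 2).
  by case/andP: t_range; lra.
- case=> _ [t [/andP[_ /den_lt0 dt] ht dht]].
  pose w : 'cV[R]_n.+1 := \col_i (2 * psi i 0 / (t - 2 * nu + 2 * alpha 0 i)).
  have crit i : (t - 2 * nu + 2 * alpha 0 i) * w i 0 = 2 * psi i 0.
    by rewrite mxE mulrC divfK// lt_eqF.
  have [hE dhE] := secular_critical _ _ dt crit.
  (* [h(t) = 0] says precisely that [t] is the squared norm of this [w], the point at which
     [local_maximizerP] evaluates the denominators. *)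
  have tE : \sum_i w i 0 ^+ 2 = t by apply/eqP; rewrite -subr_eq0 -hE ht.
  exists w; apply/local_maximizerP; rewrite tE; split=> //.
  by move: dht; rewrite dhE; lra.
- move=> w t wmax /andP[_ /den_lt0 dt] ht dht.
  (* The squared norm of [w] is itself an admissible zero, so uniqueness identifies it with [t]. *)
  have [/andP[_ /den_lt0 ds] hs dhs] := critical _ wmax.
  have [_ crit _] := (local_maximizerP _).1 wmax.
  rewrite -(secular_root_unique _ _ ds dt hs ht dhs dht).
  by apply/colP => i; rewrite mxE -crit mulrC mulKf// lt_eqF.
Qed.
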